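(* Let $n\ge 2$, $r>0$, $m\ge 1$, and let $g$ be polyharmonic of degree $m$ (harmonic if $m=1$), i.e. $g\in C^{2m}$ and $\Delta^m g=0$, in a domain of $\mathbb{R}^n$ containing $I_n=\{\bm{x}\in\mathbb{R}^n: |x_i|\le r,\ i=1,\dots,n\}$. Let $\varphi\in C^{2m}[0,r]$ satisfy $\varphi^{(k)}(0)=0$ for $k=0,1,\dots,2m-1$. Then, with $M(\bm{x})=\max_{1\le i\le n}|x_i|$, $$\int_{I_n}\varphi^{(2m)}(r-M)\,g\,d\lambda_n=2\sum_{s=0}^{m-1}\int_{D_n}\varphi^{(2s+1)}(r-M)\,\Delta^{m-s-1}g\,d\lambda_{n-1}.$$
   Context: $\Delta$ is the Laplacian and $\Delta^m$ its $m$-th iterate ($\Delta^0 g=g$); $\varphi^{(j)}$ is the $j$-th derivative of $\varphi$; $\lambda_n$ is Lebesgue measure on $\mathbb{R}^n$. For $1\le i<j\le n$, $D^{ij}_n=\{\bm{x}\in I_n : |x_k|\le |x_i|=|x_j| \text{ for all } k\ne i,j\}$, and $D_n=\bigcup_{1\le i<j\le n}D^{ij}_n$. On $D_n$, $\lambda_{n-1}$ denotes the measure obtained on each piece $D^{ij}_n$ by parametrizing it by the coordinates other than $x_i$ and taking $(n-1)$-dimensional Lebesgue measure in those coordinates (equivalently, $1/\sqrt2$ times the $(n-1)$-dimensional surface measure). *)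

(* Defs.v *)
From HB Require Import structures.
From mathcomp Require Import all_boot all_order all_algebra.
From mathcomp Require Import all_classical all_reals all_analysis.
Set Implicit Arguments. Unset Strict Implicit. Unset Printing Implicit Defensive.
Import Order.TTheory GRing.Theory Num.Theory.
Import numFieldNormedType.Exports.
Local Open Scope classical_set_scope.
Local Open Scope ring_scope.

Section Defs.
Context {R : realType}.

Definition evec (n : nat) (i : 'I_n) : 'rV[R]_n := \row_(k < n) (k == i)%:R.

Definition partial (n : nat) (i : 'I_n) (f : 'rV[R]_n -> R) : 'rV[R]_n -> R :=
  fun x => 'D_(evec i) f x.

Definition lap (n : nat) (f : 'rV[R]_n -> R) : 'rV[R]_n -> R :=
  fun x => \sum_(i < n) partial i (partial i f) x.

Fixpoint Ck (n : nat) (k : nat) (U : set 'rV[R]_n) (f : 'rV[R]_n -> R) : Prop :=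
  (forall x, U x -> {for x, continuous f}) /\
  match k with
  | 0 => True
  | k'.+1 => forall i : 'I_n,
      (forall x, U x -> derivable f x (evec i)) /\ Ck k' U (partial i f)
  end.

Definition deriv_on (a b : R) (f f' : R -> R) : Prop :=
  forall x, a <= x <= b ->
    (fun y => (f y - f x) / (y - x)) @
       within [set y | a <= y <= b /\ y != x] (nbhs x) --> f' x.

Definition cube (r : R) (n : nat) : set 'rV[R]_n :=
  [set x | forall i : 'I_n, `|x ord0 i| <= r].

Definition Mx (n : nat) (x : 'rV[R]_n) : R := \big[Num.max/0]_(i < n) `|x ord0 i|.

Fixpoint iint (r : R) (S : pred nat) (K : nat) (F : (nat -> R) -> R) : R :=
  match K with
  | 0 => F (fun _ => 0)
  | K'.+1 =>
      if S K' then
        Rintegral (@lebesgue_measure R) [set t | - r <= t <= r]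
          (fun t => iint r S K' (fun y => F (fun j => if j == K' then t else y j)))
      else iint r S K' F
  end.

Definition cube_int (r : R) (n : nat) (f : 'rV[R]_n -> R) : R :=
  iint r predT n (fun x => f (\row_(l < n) x l)).

(* integral over D^{ij}_n with respect to lambda_{n-1}: parametrize by the
   coordinates other than x_i; each such parameter point y (with
   |y_k| <= |y_j| <= r) corresponds to the two points x_i = y_j and x_i = -y_j *)
Definition Dij_int (r : R) (n : nat) (i j : 'I_n) (f : 'rV[R]_n -> R) : R :=
  iint r (fun k => k != (i : nat)) n (fun x =>
    if `[< forall k : 'I_n, k != i -> k != j -> `|x k| <= `|x j| >] then
      f (\row_(l < n) (if l == i then x j else x l)) +
      f (\row_(l < n) (if l == i then - x j else x l))
    else 0).

(* integral over D_n = union of the D^{ij}_n (pairwise overlaps are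
   lambda_{n-1}-null) *)
Definition Dn_int (r : R) (n : nat) (f : 'rV[R]_n -> R) : R :=
  \sum_(i < n) \sum_(j < n | (i < j)%N) Dij_int r i j f.

End Defs.

(* Main.v *)
Require Import Defs.
From HB Require Import structures.
From mathcomp Require Import all_boot all_order all_algebra.
From mathcomp Require Import all_classical all_reals all_analysis.
From mathcomp Require Import measurable_realfun ring lra.
Import Order.TTheory GRing.Theory Num.Theory.
Import numFieldNormedType.Exports.
Local Open Scope classical_set_scope.
Local Open Scope ring_scope.

(* The theorem telescopes the case of a single Laplacian: if psi is C^2 on
   [0,r] with psi(0) = psi'(0) = 0 and G is C^2 near the cube, then
     int_I psi''(r-M) G = int_I psi(r-M) (lap G) + 2 int_D psi'(r-M) G,
   applied to psi = phi^(2s) and G = lap^(m-s-1) g for s = 0, ..., m-1.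
   For this identity, fix i and all coordinates but x_i, and let a be the
   largest |x_k|, k <> i. Along the line psi(r-M) = psi(r - max(|x_i|, a)) is
   constant for |x_i| <= a, so integrating by parts twice on [-r,-a], [-a,a]
   and [a,r] gives
     int_{a < |x_i|} psi''(r-M) G - int psi(r-M) d_i^2 G
       = psi'(r-a) (G(x_i = a) + G(x_i = -a)).
   Up to a null set the regions {a < |x_i|} partition the cube, and a = |x_j|
   for some j <> i, so that summing over i yields the integrals over all
   D^{ij} with i <> j, each D^{ij} being counted twice. *)

(** * Integrals of bounded measurable functions *)

Section BoundedFubini.
Context {R : realType}.

Lemma bounded_integrable d (T : measurableType d) (m : {measure set T -> \bar R})
    (A : set T) (f : T -> R) :
  measurable A -> (m A < +oo)%E -> measurable_fun A f ->
  (exists B, forall t, A t -> `|f t| <= B) -> m.-integrable A (EFin \o f).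
Proof.
move=> mA mAy mf [B Bf]; apply: measurable_bounded_integrable => //.
exists B; split; first exact: num_real.
by move=> M BM x Ax; apply: le_trans (Bf _ Ax) (ltW BM).
Qed.

(** A bounded function is integrable over a rectangle of finite measure, so Fubini applies to [F]
    times the indicator of that rectangle. *)
Lemma Rintegral_swap d1 d2 (T1 : measurableType d1) (T2 : measurableType d2)
    (m1 : {sigma_finite_measure set T1 -> \bar R})
    (m2 : {sigma_finite_measure set T2 -> \bar R})
    (A1 : set T1) (A2 : set T2) (F : T1 * T2 -> R) :
  measurable A1 -> measurable A2 -> (m1 A1 < +oo)%E -> (m2 A2 < +oo)%E ->
  measurable_fun setT F -> (exists B, forall z, `|F z| <= B) ->
  Rintegral m1 A1 (fun s => Rintegral m2 A2 (fun t => F (s, t))) =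
  Rintegral m2 A2 (fun t => Rintegral m1 A1 (fun s => F (s, t))).
Proof.
move=> mA1 mA2 fA1 fA2 mF [B BF].
pose H z := F z * \1_(A1 `*` A2) z.
have mA : measurable (A1 `*` A2) by exact: measurableX.
have iH : (m1 \x m2)%E.-integrable setT (EFin \o H).
  rewrite [EFin \o H](_ : _ = (EFin \o F) \_ (A1 `*` A2)).
    apply/(integrable_mkcond _ mA)/bounded_integrable => //.
    - rewrite /= product_measure1E//.
      by apply: lte_mul_pinfty => //; rewrite ge0_fin_numE.
    - exact: measurable_funTS.
    - by exists B.
  apply/funext => z; rewrite patchE /= /H indicE.
  by case: (z \in _); rewrite ?mulr1 ?mulr0.
have := Fubini iH.
have E1 s : (\int[m2]_t (EFin \o H) (s, t) =
    if s \in A1 then (Rintegral m2 A2 (fun t => F (s, t)))%:E else 0)%E.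
  case: (boolP (s \in A1)) => sA.
    rewrite /Rintegral fineK; last first.
      apply: integrable_fin_num => //; apply: bounded_integrable => //; last by exists B.
      by apply: measurable_funTS; exact: (measurableT_comp mF).
    rewrite [RHS]integral_mkcond; apply: eq_integral => t _.
    rewrite patchE /= /H indicE in_setX sA /=.
    by case: (t \in _); rewrite ?mulr1 ?mulr0.
  rewrite integral0_eq// => t _ /=; rewrite /H indicE in_setX (negbTE sA) /=.
  by rewrite mulr0.
have E2 t : (\int[m1]_s (EFin \o H) (s, t) =
    if t \in A2 then (Rintegral m1 A1 (fun s => F (s, t)))%:E else 0)%E.
  case: (boolP (t \in A2)) => tA.
    rewrite /Rintegral fineK; last first.
      apply: integrable_fin_num => //; apply: bounded_integrable => //; last by exists B.
      by apply: measurable_funTS; exact: (measurableT_comp mF).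
    rewrite [RHS]integral_mkcond; apply: eq_integral => s _.
    rewrite patchE /= /H indicE in_setX tA andbT /=.
    by case: (s \in _); rewrite ?mulr1 ?mulr0.
  rewrite integral0_eq// => s _ /=; rewrite /H indicE in_setX (negbTE tA) andbF /=.
  by rewrite mulr0.
under eq_integral do rewrite E1.
under [X in _ = X -> _]eq_integral do rewrite E2.
move=> E; rewrite [LHS]Rintegral_mkcond [RHS]Rintegral_mkcond /Rintegral.
congr fine; transitivity (\int[m1]_x
    (if x \in A1 then (Rintegral m2 A2 (fun t => F (x, t)))%:E else 0))%E.
  by apply: eq_integral => x _; rewrite patchE; case: ifP.
by rewrite E; apply: eq_integral => x _; rewrite patchE; case: ifP.
Qed.

End BoundedFubini.

(** * Integrals over [-r, r] depending on a parameter *)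

Section BoundedMeasurable.
Context {R : realType} (r : R).
Local Notation mu := (@lebesgue_measure R).
Local Notation D := [set t : R | - r <= t <= r].

(** For [r >= 0], the retraction of the line onto [-r, r]. Composing with it makes integrands that
    are controlled only on the segment measurable and bounded everywhere, without changing the
    integral. *)
Definition clamp (t : R) : R := Num.max (- r) (Num.min t r).

Lemma clamp_id t : D t -> clamp t = t.
Proof. by move=> /andP[a b]; rewrite /clamp min_l// max_r. Qed.

Lemma clamp_norm t : 0 < r -> `|clamp t| <= r.
Proof.
move=> r0; rewrite ler_norml /clamp le_max lexx/= ge_max ge_min lexx orbT andbT.
by rewrite -subr_ge0 opprK addr_ge0// ltW.
Qed.

Lemma measurable_clamp : measurable_fun setT clamp.
Proof.
by apply: measurable_maxr => //; apply: measurable_minr.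
Qed.

Lemma segE : D = [set` `[- r, r]%R].
Proof. by apply/seteqP; split => x /=; rewrite in_itv. Qed.

Lemma measurable_seg : measurable D.
Proof. by rewrite segE; exact: measurable_itv. Qed.

Lemma mu_seg_lty : (mu D < +oo)%E.
Proof.
by rewrite segE lebesgue_measure_itv/=; case: ifP => _; rewrite ?ltry// -EFinD ltry.
Qed.

(** Adding the bound [B] makes the integrand nonnegative, so measurability comes from Tonelli's
    theorem; the integral of the constant is subtracted afterwards. *)
Lemma measurable_param d (T : measurableType d) (F : T * R -> R) :
  measurable_fun setT F -> (exists B, forall z, `|F z| <= B) ->
  measurable_fun setT (fun x => Rintegral mu D (fun t => F (x, t))).
Proof.
move=> mF [B BF].
have iF x : mu.-integrable D (EFin \o (fun t => F (x, t))).
  apply: bounded_integrable; [exact: measurable_seg|exact: mu_seg_lty| |by exists B].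
  by apply: measurable_funTS; exact: (measurableT_comp mF).
have iB : mu.-integrable D (EFin \o (fun t => B)).
  apply: bounded_integrable; [exact: measurable_seg|exact: mu_seg_lty| |by exists `|B|].
  exact: measurable_cst.
pose H (z : T * R) : \bar R := ((F z + B) * \1_D z.2)%:E.
have H0 z : setT z -> (0 <= H z)%E.
  move=> _; rewrite lee_fin mulr_ge0// -lerBlDr sub0r.
  by have := BF z; rewrite ler_norml => /andP[].
have mH : measurable_fun setT H.
  apply/measurable_EFinP; apply: measurable_funM.
    exact: measurable_funD.
  apply: (@measurableT_comp _ _ _ _ _ _ (\1_D : R -> R)) => //.
  exact: (measurable_indic measurable_seg).
have := measurable_fun_fubini_tonelli_F (m2 := mu) H mH.
rewrite (_ : (fun x => _) = fun x =>
   fine (fubini_F mu H x) - Rintegral mu D (fun=> B)); last first.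
  apply/funext => x; rewrite /fubini_F.
  rewrite -[LHS](addrK (Rintegral mu D (fun=> B))) -RintegralD//; last first.
    exact: measurable_seg.
  rewrite Rintegral_mkcond /Rintegral; congr (fine _ - _).
  apply: eq_integral => t _; rewrite /H /= patchE indicE.
  by case: (t \in D); rewrite ?mulr1 ?mulr0.
move=> mfub; apply: measurable_funB => //.
apply: measurableT_comp => //.
apply: mfub => z; exact: H0.
Qed.

End BoundedMeasurable.

(** * Iterated integrals over the cube *)

Section IteratedIntegral.
Set Implicit Arguments. Unset Strict Implicit.
Context {R : realType} (r : R).
Hypothesis r_gt0 : 0 < r.
Local Notation mu := (@lebesgue_measure R).
Local Notation D := [set t : R | - r <= t <= r].
Implicit Types (y : nat -> R) (F G : (nat -> R) -> R) (S : pred nat) (i j k K : nat).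

Definition upd (y : nat -> R) (i : nat) (t : R) : nat -> R :=
  fun j => if j == i then t else y j.

Lemma updC y i j s t : i != j -> upd (upd y i s) j t = upd (upd y j t) i s.
Proof.
move=> ij; apply/funext => k; rewrite /upd.
by case: eqP => // ->; rewrite eq_sym (negbTE ij).
Qed.

Lemma updE y i t : upd y i t i = t.
Proof. by rewrite /upd eqxx. Qed.

Lemma updN y i j t : j != i -> upd y i t j = y j.
Proof. by rewrite /upd => /negbTE ->. Qed.

(** The bound concerns every index, also those beyond the dimension, so that it is stable under
    [upd] at any index. *)
Definition incube (y : nat -> R) := forall j, `|y j| <= r.

Lemma incube_upd y i t : incube y -> - r <= t <= r -> incube (upd y i t).
Proof. by move=> yc tD j; rewrite /upd; case: eqP => // _; rewrite ler_norml. Qed.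

Lemma incube0 : incube (fun=> 0).
Proof. by move=> j; rewrite normr0 ltW. Qed.

(* Joint measurability in the coordinates, without putting a sigma-algebra on
   [nat -> R]: measurability is tested along all measurable families. *)
Definition cmeas d' (T' : measurableType d') (F : (nat -> R) -> T') :=
  forall d (T : measurableType d) (h : T -> nat -> R),
    (forall j, measurable_fun setT (fun t => h t j)) ->
    (forall t, incube (h t)) -> measurable_fun setT (fun t => F (h t)).

(** The class of integrands used throughout: stable under sums, products, case distinctions,
    substitutions and [coord_int], and integrable along every coordinate line of the cube. *)
Definition bmeas F := cmeas F /\ exists B, forall y, incube y -> `|F y| <= B.

Lemma eq_bmeas F G : bmeas F -> F =1 G -> bmeas G.
Proof. by move=> gF /funext <-. Qed.

Lemma bmeas_cst c : bmeas (fun=> c).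
Proof.
by split => [d T h _ _|]; [exact: measurable_cst|exists `|c|].
Qed.

Lemma bmeasD F G : bmeas F -> bmeas G -> bmeas (fun y => F y + G y).
Proof.
move=> [mF [B BF]] [mG [C CG]]; split => [d T h mh hc|].
  by apply: measurable_funD; [exact: mF|exact: mG].
exists (B + C) => y yc; apply: le_trans (ler_normD _ _) _.
by apply: lerD; [exact: BF|exact: CG].
Qed.

Lemma bmeasM F G : bmeas F -> bmeas G -> bmeas (fun y => F y * G y).
Proof.
move=> [mF [B BF]] [mG [C CG]]; split => [d T h mh hc|].
  by apply: measurable_funM; [exact: mF|exact: mG].
by exists (B * C) => y yc; rewrite normrM ler_pM// ?BF ?CG.
Qed.

Lemma bmeasN F : bmeas F -> bmeas (fun y => - F y).
Proof.
move=> gF; rewrite (_ : (fun y => _) = fun y => -1 * F y).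
  by apply: bmeasM => //; exact: bmeas_cst.
by apply/funext => y; rewrite mulN1r.
Qed.

Lemma bmeas_sum (I : Type) (s : seq I) (P : pred I) (F : I -> (nat -> R) -> R) :
  (forall a, P a -> bmeas (F a)) -> bmeas (fun y => \sum_(a <- s | P a) F a y).
Proof.
move=> gF; elim: s => [|a s IH].
  by apply: (eq_bmeas (bmeas_cst 0)) => y; rewrite big_nil.
case: (boolP (P a)) => Pa; last first.
  by apply: (eq_bmeas IH) => y; rewrite big_cons (negbTE Pa).
by apply: (eq_bmeas (bmeasD (gF _ Pa) IH)) => y; rewrite big_cons Pa.
Qed.

Lemma bmeas_if (P : (nat -> R) -> bool) F G : cmeas P -> bmeas F -> bmeas G ->
  bmeas (fun y => if P y then F y else G y).
Proof.
move=> mP [mF [B BF]] [mG [C CG]]; split => [d T h mh hc|].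
  by apply: measurable_fun_ifT; [exact: mP|exact: mF|exact: mG].
by exists (Num.max B C) => y yc; case: ifP => _; rewrite le_max (BF, CG)// orbT.
Qed.

Lemma bmeas_subst F (s : (nat -> R) -> nat -> R) :
  (forall j, cmeas (fun y => s y j)) -> (forall y, incube y -> incube (s y)) ->
  bmeas F -> bmeas (fun y => F (s y)).
Proof.
move=> ms sc [mF [B BF]]; split => [d T h mh hc|].
  apply: (mF _ _ (fun t => s (h t))) => [j|t]; last exact: sc.
  exact: ms.
by exists B => y yc; apply/BF/sc.
Qed.

Definition coord_int i F : (nat -> R) -> R :=
  fun y => \int[mu]_(t in D) F (upd y i t).

Lemma bmeas_integrable F y i : bmeas F -> incube y ->
  mu.-integrable D (EFin \o (fun t => F (upd y i t))).
Proof.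
move=> [mF [B BF]] yc; apply: bounded_integrable.
- exact: measurable_seg.
- exact: mu_seg_lty.
(* [cmeas] only tests families that stay in the cube, hence the clamped variable. *)
- apply: (eq_measurable_fun (fun t => F (upd y i (clamp r t)))).
    by move=> t /[!inE] tD; rewrite clamp_id.
  apply: measurable_funTS; apply: (mF _ _ (fun t => upd y i (clamp r t))).
    move=> j; rewrite /upd; case: eqP => _; last exact: measurable_cst.
    exact: measurable_clamp.
  by move=> t; apply: incube_upd => //; rewrite -ler_norml clamp_norm.
- by exists B => t tD; apply/BF/incube_upd.
Qed.

Lemma coord_int_ext i F G y : (forall y, incube y -> F y = G y) -> incube y ->
  coord_int i F y = coord_int i G y.
Proof.
by move=> FG yc; apply: eq_Rintegral => t /[!inE] tD; apply/FG/incube_upd.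
Qed.

Lemma coord_intD i F G y : bmeas F -> bmeas G -> incube y ->
  coord_int i (fun y => F y + G y) y = coord_int i F y + coord_int i G y.
Proof.
move=> gF gG yc; rewrite /coord_int -RintegralD//.
- exact: measurable_seg.
- exact: bmeas_integrable.
- exact: bmeas_integrable.
Qed.

Lemma bmeas_coord_int i F : bmeas F -> bmeas (coord_int i F).
Proof.
move=> gF; have [mF [B BF]] := gF; split => [d T h mh hc|].
  rewrite (_ : (fun t => _) = fun x => \int[mu]_(t in D) F (upd (h x) i (clamp r t))).
    apply: (@measurable_param _ r _ _ (fun z : T * R => F (upd (h z.1) i (clamp r z.2)))).
      apply: (mF _ _ (fun z : T * R => upd (h z.1) i (clamp r z.2))) => [j|z].
        rewrite /upd; case: eqP => _; last exact: (measurableT_comp (mh j)).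
        exact: (measurableT_comp (measurable_clamp _)).
      by apply: incube_upd => //; rewrite -ler_norml clamp_norm.
    exists B => z; apply/BF/incube_upd => //; by rewrite -ler_norml clamp_norm.
  by apply/funext => x; apply: eq_Rintegral => t /[!inE] tD; rewrite clamp_id.
exists (\int[mu]_(t in D) `|B|) => y yc.
apply: le_trans (le_normr_Rintegral _ _) _.
- exact: measurable_seg.
- exact: bmeas_integrable.
- apply: le_Rintegral.
  + exact: measurable_seg.
  + apply: (@bmeas_integrable (fun y => `|F y|) y i _ yc); split.
      by move=> d T h mh hc; apply: measurableT_comp => //; exact: mF.
    by exists B => z zc; rewrite normr_id BF.
  + by apply: (@bmeas_integrable (fun y => `|B|) y i _ yc); exact: bmeas_cst.
  + by move=> t tD; rewrite (le_trans _ (ler_norm _))// BF//; exact: incube_upd.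
Qed.

(** Fubini on the square in the coordinates [i] and [j], with clamped variables so that the
    integrand is measurable and bounded on the whole plane. *)
Lemma coord_intC i j F y : bmeas F -> incube y ->
  coord_int i (coord_int j F) y = coord_int j (coord_int i F) y.
Proof.
move=> gF yc; have [->//|ij] := eqVneq i j.
have [mF [B BF]] := gF.
have cc s t : incube (upd (upd y i (clamp r s)) j (clamp r t)).
  by do 2 (apply: incube_upd; rewrite // -?ler_norml ?clamp_norm//).
have [mD fD] := (@measurable_seg R r, @mu_seg_lty R r).
have := @Rintegral_swap _ _ _ _ _ mu mu D D
  (fun z => F (upd (upd y i (clamp r z.1)) j (clamp r z.2))) mD mD fD fD.
move=> /(_ _ _)/= E; transitivity (\int[mu]_(s in D) \int[mu]_(t in D)
    F (upd (upd y i (clamp r s)) j (clamp r t))).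
  apply: eq_Rintegral => s /[!inE] sD; apply: eq_Rintegral => t /[!inE] tD.
  by rewrite !clamp_id.
rewrite E.
- apply: eq_Rintegral => s /[!inE] sD; apply: eq_Rintegral => t /[!inE] tD.
  by rewrite (clamp_id _ _ sD) (clamp_id _ _ tD) (updC y t s ij).
- apply: (mF _ _ (fun z => upd (upd y i (clamp r z.1)) j (clamp r z.2))) => [k|z].
    rewrite /upd; case: eqP => _; first exact: (measurableT_comp (measurable_clamp _)).
    case: eqP => _; first exact: (measurableT_comp (measurable_clamp _)).
    exact: measurable_cst.
  exact: cc.
- by exists B => z; exact: BF.
Qed.

(** Unlike [iint], this remains a function of the base point, so that [coord_int] can be applied to
    it again. The largest index is the outermost variable. *)
Fixpoint multi_int S K F : (nat -> R) -> R :=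
  if K is K'.+1 then
    if S K' then coord_int K' (multi_int S K' F) else multi_int S K' F
  else F.

(** Only indices below [K] are integrated, so an update at [L >= K] commutes with each
    integration. *)
Lemma multi_int_upd S K L F t y : (K <= L)%N ->
  multi_int S K (fun z => F (upd z L t)) y = multi_int S K F (upd y L t).
Proof.
elim: K y => //= K IH y KL; case: ifP => _; last exact/IH/ltnW.
rewrite /coord_int; apply: eq_Rintegral => s _; rewrite (IH _ (ltnW KL)) (updC y s t)//.
by rewrite ltn_eqF.
Qed.

Lemma iintE S K F : iint r S K F = multi_int S K F (fun=> 0).
Proof.
elim: K F => //= K IH F; case: ifP => _; last exact: IH.
apply: eq_Rintegral => t _; rewrite IH; exact: multi_int_upd.
Qed.

Lemma multi_int_ext S K F G y : (forall y, incube y -> F y = G y) -> incube y ->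
  multi_int S K F y = multi_int S K G y.
Proof.
move=> FG; elim: K y => [|K IH] y yc /=; first exact: FG.
by case: ifP => _; [exact: coord_int_ext|exact: IH].
Qed.

Lemma eq_multi_int S S' K F : (forall k, (k < K)%N -> S k = S' k) ->
  multi_int S K F = multi_int S' K F.
Proof.
elim: K => //= K IH SS'; rewrite SS'// IH// => k kK.
by apply: SS'; rewrite ltnS ltnW.
Qed.

Lemma bmeas_multi_int S K F : bmeas F -> bmeas (multi_int S K F).
Proof.
by move=> gF; elim: K => //= K IH; case: ifP => // _; exact: bmeas_coord_int.
Qed.

Lemma multi_intD S K F G y : bmeas F -> bmeas G -> incube y ->
  multi_int S K (fun y => F y + G y) y = multi_int S K F y + multi_int S K G y.
Proof.
move=> gF gG; elim: K y => //= K IH y yc; case: ifP => _; last exact: IH.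
by rewrite -coord_intD; [exact: coord_int_ext|exact: bmeas_multi_int..|].
Qed.

Lemma multi_int_cst0 S K y : multi_int S K (fun=> 0) y = 0.
Proof.
elim: K y => //= K IH y; case: ifP => _; last exact: IH.
rewrite /coord_int; under eq_Rintegral do rewrite IH.
by rewrite Rintegral_cst ?mul0r//; exact: measurable_seg.
Qed.

Lemma multi_int_sum (I : Type) (s : seq I) (P : pred I) S K
    (F : I -> (nat -> R) -> R) y :
  (forall a, P a -> bmeas (F a)) -> incube y ->
  multi_int S K (fun y => \sum_(a <- s | P a) F a y) y =
  \sum_(a <- s | P a) multi_int S K (F a) y.
Proof.
move=> gF yc; elim: s => [|a s IH].
  rewrite big_nil; transitivity (multi_int S K (fun=> 0) y); last exact: multi_int_cst0.
  by apply: multi_int_ext => // z _; rewrite big_nil.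
rewrite big_cons; case: ifPn => Pa; rewrite -IH.
  rewrite -multi_intD//; [|exact: gF|exact: bmeas_sum].
  by apply: multi_int_ext => // z _; rewrite big_cons Pa.
by apply: multi_int_ext => // z _; rewrite big_cons (negbTE Pa).
Qed.

Lemma multi_int_coord_int S K i F y : bmeas F -> incube y ->
  coord_int i (multi_int S K F) y = multi_int S K (coord_int i F) y.
Proof.
move=> gF; elim: K y => //= K IH y yc; case: ifP => _; last exact: IH.
rewrite coord_intC//; last exact: bmeas_multi_int.
exact: coord_int_ext.
Qed.

(** Repeated Fubini moves the integration over coordinate [i] innermost. This is what permits fixing
    all other coordinates and arguing on one line. *)
Lemma multi_int_pull S K i F y : (i < K)%N -> S i -> bmeas F -> incube y ->
  multi_int S K F y = multi_int (predD1 S i) K (coord_int i F) y.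
Proof.
move=> + Si gF; elim: K y => //= K IH y + yc; rewrite ltnS leq_eqVlt.
have [<-{IH}/= _|iK /= ltiK] := eqVneq i K.
  rewrite Si multi_int_coord_int//.
  by congr (_ y); apply: eq_multi_int => k ki /=; rewrite (ltn_eqF ki).
case: ifP => _; last exact: IH.
by apply: coord_int_ext => // z zc; exact: IH.
Qed.

End IteratedIntegral.

(** * Calculus on a line *)

Section Line.
Set Implicit Arguments. Unset Strict Implicit.
Context {R : realType}.
Local Notation mu := (@lebesgue_measure R).

(** The points [c] and [-c] form a null set. In the applications [c] is the largest modulus of other
    coordinates, so that ties can be ignored. *)
Lemma Rintegral_except (A : set R) (c : R) (f g : R -> R) :
  measurable A -> measurable_fun A f -> measurable_fun A g ->
  (forall t, A t -> `|t| != c -> f t = g t) ->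
  \int[mu]_(t in A) f t = \int[mu]_(t in A) g t.
Proof.
move=> mA mf mg fg; congr fine; apply: ae_eq_integral => //.
- exact/measurable_EFinP.
- exact/measurable_EFinP.
have N : mu.-negligible [set c; - c].
  exists [set c; - c]; split => //.
    by apply: measurableU; exact: measurable_set1.
  exact: (countable_lebesgue_measure0 (finite_set_countable (finite_set2 _ _))).
apply: negligibleS N => t /= /not_implyP[At]; apply: contra_notP.
move=> tc; rewrite fg//; apply/eqP => tE; apply: tc.
by rewrite -tE; case: (ler0P t) => _; [right; rewrite opprK|left].
Qed.

(** Degenerate intervals are included because the splitting points [-a] and [a] may meet each other
    or the ends of [-r, r]. *)
Lemma Rintegral_FTC2 (a b : R) (F f : R -> R) : a <= b ->
  (forall x, a <= x <= b -> {for x, continuous F}) ->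
  (forall x, a <= x <= b -> {for x, continuous f}) ->
  (forall x, a < x < b -> is_derive x 1 F (f x)) ->
  \int[mu]_(t in `[a, b]) f t = F b - F a.
Proof.
rewrite le_eqVlt => /predU1P[<-|ab] cF cf dF.
  by rewrite set_itv1 Rintegral_set1 subrr.
rewrite /Rintegral (@continuous_FTC2 _ f F)//.
- apply: continuous_in_subspaceT => x; rewrite inE/= in_itv/=; exact: cf.
- split.
  + by move=> x; rewrite in_itv/= => /dF[].
  + by apply: cvg_at_right_filter; apply: cF; rewrite lexx ltW.
  + by apply: cvg_at_left_filter; apply: cF; rewrite lexx ltW.
- by move=> x; rewrite in_itv/= => /dF [_ <-]; rewrite derive1E.
Qed.

Lemma deriv_on_is_derive (a b : R) (f f' : R -> R) x :
  deriv_on a b f f' -> a < x < b -> is_derive x 1 f (f' x).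
Proof.
move=> df /andP[ax xb].
have := df x; rewrite !ltW// => /(_ isT) D.
have L : h^-1 *: ((f \o shift x) (h *: (1 : R)) - f x) @[h --> 0^'] --> f' x.
  apply/cvgrPdist_lt => e e0.
  have /cvgrPdist_lt/(_ _ e0) := D; rewrite near_withinE.
  move=> /nbhs_ballP[d /= d0 Hd].
  rewrite near_withinE; apply/nbhs_ballP.
  (* This radius keeps [h + x] in [a, b], where [deriv_on] controls the quotient. *)
  exists (Num.min d (Num.min (x - a) (b - x))) => /=.
    by rewrite !lt_min d0 !subr_gt0 ax.
  move=> h /=; rewrite /ball/= sub0r normrN !lt_min => /and3P[hd ha hb] h0.
  have := Hd (h + x); rewrite /ball/= opprD addrA addrAC subrr sub0r addrK normrN.
  rewrite mulrC => H; rewrite /GRing.scale/= mulr1; apply: H => //; split.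
    move: ha hb; rewrite !ltr_norml => /andP[h1 h2] /andP[h3 h4]; lra.
  by apply: contra h0 => /eqP E; apply/eqP/(addIr x); rewrite E add0r.
apply: DeriveDef; first by apply/cvg_ex; exists (f' x).
exact/cvg_lim.
Qed.

Variables (r a : R) (p0 p1 p2 g0 g1 g2 : R -> R).
Hypotheses (a_ge0 : 0 <= a) (a_le : a <= r).
Hypotheses (p0c : continuous p0) (p1c : continuous p1) (p2c : continuous p2).
Hypothesis p0d : forall x : R, 0 < x < r -> is_derive x 1 p0 (p1 x).
Hypothesis p1d : forall x : R, 0 < x < r -> is_derive x 1 p1 (p2 x).
Hypotheses (p00 : p0 0 = 0) (p10 : p1 0 = 0).
Hypothesis g0d : forall t : R, - r <= t <= r -> is_derive t 1 g0 (g1 t).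
Hypothesis g1d : forall t : R, - r <= t <= r -> is_derive t 1 g1 (g2 t).
Hypothesis g2c : forall t : R, - r <= t <= r -> {for t, continuous g2}.

Let is_derive_cont (f : R -> R) (x d : R) : is_derive x 1 f d -> {for x, continuous f}.
Proof. by move=> [df _]; apply/differentiable_continuous/derivable1_diffP. Qed.

Let compc (f : R -> R) (s x : R) :
  continuous f -> {for x, continuous (fun t => f (r + s * t))}.
Proof.
move=> cf; apply: continuous_comp; last exact: cf.
apply: cvgD; first exact: cvg_cst.
by apply: cvgM; [exact: cvg_cst|exact: cvg_id].
Qed.

Let compd (f : R -> R) (s x d : R) : is_derive (r + s * x) 1 f d ->
  is_derive x 1 (fun t => f (r + s * t)) (s * d).
Proof.
move=> df; have ds : is_derive x 1 (fun t : R => r + s * t) s.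
  have D := is_deriveD (is_derive_cst r x 1) (is_deriveZ s (is_derive_id x (1 : R))).
  by apply: is_derive_eq D _; rewrite add0r /GRing.scale/= mulr1.
have := @is_derive1_comp _ f (fun t => r + s * t) x d s df ds.
by rewrite mulrC.
Qed.

(* [r - `|t|] is [r + s * t] with [s = 1] for [t <= 0] and [s = -1] for [0 <= t]. *)
Let prim (s : R) (t : R) := p1 (r + s * t) * (s * g0 t) - p0 (r + s * t) * g1 t.
Let primd (s : R) (t : R) := p2 (r + s * t) * g0 t - p0 (r + s * t) * g2 t.

(** In the derivative of [prim s] the two terms [s * p1 * g1] cancel, and the chain rule puts the
    factor [s * s = 1] in front of [p2]. *)
Let prim_ftc s x y : s * s = 1 -> - r <= x -> x <= y -> y <= r ->
  (forall t, x < t < y -> 0 < r + s * t < r) ->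
  \int[mu]_(t in `[x, y]) primd s t = prim s y - prim s x.
Proof.
move=> ss rx xy yr xyr.
have inr t : x <= t <= y -> - r <= t <= r.
  by move=> /andP[xt ty]; rewrite (le_trans rx xt) (le_trans ty yr).
apply: Rintegral_FTC2 => // t txy.
- apply: cvgB; apply: cvgM; try exact: compc.
    apply: cvgM; first exact: cvg_cst.
    exact: is_derive_cont (g0d (inr _ txy)).
  exact: is_derive_cont (g1d (inr _ txy)).
- apply: cvgB; apply: cvgM; try exact: compc.
    exact: is_derive_cont (g0d (inr _ txy)).
  exact: g2c (inr _ txy).
have tr := xyr _ txy.
have {}txy : - r <= t <= r by apply: inr; case/andP: txy => *; rewrite !ltW.
have D0 := g0d txy; have D1 := g1d txy.
have P0 := compd (p0d tr); have P1 := compd (p1d tr).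
have C : is_derive t 1 (cst s : R -> R) 0 by exact: is_derive_cst.
have E : is_derive t 1 (prim s) _ :=
  is_deriveB (is_deriveM P1 (is_deriveM C D0)) (is_deriveM P0 D1).
apply: (is_derive_eq E); rewrite /primd /GRing.scale/= /cst.
transitivity ((s * s) * p2 (r + s * t) * g0 t - p0 (r + s * t) * g2 t); last first.
  by rewrite ss mul1r.
have -> : ((fun=> s) * g0) t = s * g0 t by [].
ring.
Qed.

(** [A] is left open at [|t| = a], a null set. The boundary terms at [r] and [-r] vanish because
    [p0] and [p1] vanish at 0; the terms in [p0 (r - a)] at [a] and [-a] cancel between the outer
    intervals and the middle one; those in [p1 (r - a)] survive. *)
Lemma line_green (A : R -> bool) (h : R -> R) :
  (forall t, - r <= t <= r -> h t =
    (if A t then p2 (r - Num.max `|t| a) * g0 t else 0) -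
    p0 (r - Num.max `|t| a) * g2 t) ->
  (forall t, a < `|t| -> A t) -> (forall t, `|t| < a -> ~~ A t) ->
  mu.-integrable [set t | - r <= t <= r] (EFin \o h) ->
  \int[mu]_(t in [set t | - r <= t <= r]) h t = p1 (r - a) * (g0 a + g0 (- a)).
Proof.
move=> hE Aa aA; rewrite segE => ih.
have ra : - r <= - a by rewrite lerN2.
have aa : - a <= a by rewrite ge0_cp.
have r_ge0 := le_trans a_ge0 a_le.
have sub (x y : R) : - r <= x -> y <= r -> `[x, y] `<=` `[- r, r].
  move=> rx yr t /=; rewrite !in_itv/= => /andP[xt ty].
  by rewrite (le_trans rx xt) (le_trans ty yr).
have isub (x y : R) : - r <= x -> y <= r -> mu.-integrable `[x, y] (EFin \o h).
  by move=> rx yr; apply: integrableS ih => //; exact: sub.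
have split (x y z : R) : - r <= x -> x <= y -> y <= z -> z <= r ->
    \int[mu]_(t in `[x, z]) h t =
    \int[mu]_(t in `[x, y]) h t + \int[mu]_(t in `[y, z]) h t.
  move=> rx xy yz zr; rewrite -(Rintegral_itv_obnd_cbnd (r := y)); last first.
    apply: integrableS (isub y z _ _) => //; last exact: le_trans xy.
    by apply: subset_itvr; rewrite bnd_simp.
  rewrite -(@Rintegral_itvB _ h (BLeft x) (BRight z) y) ?bnd_simp//.
    by rewrite addrC subrK.
  exact: isub.
(* On each of the three intervals [h] agrees, off [|t| = a], with a continuous function [k] whose
   integral is computable. *)
have piece (x y : R) (k : R -> R) (K : R) : - r <= x -> y <= r ->
    (forall t : R, x <= t <= y -> `|t| != a -> h t = k t) ->
    (forall t : R, x <= t <= y -> {for t, continuous k}) ->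
    \int[mu]_(t in `[x, y]) k t = K -> \int[mu]_(t in `[x, y]) h t = K.
  move=> rx yr hk ck <-; apply: (@Rintegral_except _ a) => //.
  - apply/measurable_EFinP; exact: (measurable_int mu (isub _ _ rx yr)).
  - apply: subspace_continuous_measurable_fun => //.
    by apply: continuous_in_subspaceT => t; rewrite inE/= in_itv/=; exact: ck.
have primdc (s t : R) : - r <= t <= r -> {for t, continuous (primd s)}.
  move=> tr; apply: cvgB; apply: cvgM; try exact: compc.
    exact: is_derive_cont (g0d tr).
  exact: g2c tr.
rewrite (split (- r) (- a) r)//; last exact: le_trans a_le.
rewrite (split (- a) a r)//.
rewrite (piece (- r) (- a) (primd 1) (prim 1 (- a) - prim 1 (- r)))//; last 4 first.
- exact: le_trans a_le.
- move=> t /andP[t1 t2] ta.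
  have t0 : t <= 0 by rewrite (le_trans t2)// oppr_le0.
  move: ta; rewrite ler0_norm// => ta.
  have at' : a < - t by rewrite lt_neqAle eq_sym ta lerNr.
  rewrite hE ?t1 ?(le_trans t2)// ?(le_trans aa)// ler0_norm// Aa ?ler0_norm//.
  by rewrite max_l ?ltW// opprK /primd mul1r.
- move=> t /andP[t1 t2]; apply: primdc; rewrite t1 (le_trans t2)//.
  exact: le_trans a_le.
- apply: prim_ftc; rewrite ?mulr1// ?(le_trans aa)//.
  by move=> t /andP[t1 t2]; rewrite mul1r; lra.
(* For [|t| < a] the maximum is [a]: the factor [p0 (r - a)] is constant and the [p2] term is
   absent. *)
rewrite (piece (- a) a (fun t => - p0 (r - a) * g2 t)
    (- p0 (r - a) * g1 a - - p0 (r - a) * g1 (- a)))//; last 3 first.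
- move=> t /andP[t1 t2] ta.
  have ta' : `|t| < a by rewrite lt_neqAle ta ler_norml t1.
  rewrite hE ?(le_trans ra)// ?(le_trans t2)// (negbTE (aA _ ta')) sub0r.
  by rewrite max_r ?ltW// mulNr.
- move=> t /andP[t1 t2]; apply: cvgM; first exact: cvg_cst.
  by apply: g2c; rewrite (le_trans ra t1) (le_trans t2 a_le).
- apply: (@Rintegral_FTC2 (- a) a (fun t => - p0 (r - a) * g1 t)) => // t /andP[t1 t2].
  + apply: cvgM; first exact: cvg_cst.
    apply: is_derive_cont (g1d _).
    by rewrite (le_trans ra t1) (le_trans t2 a_le).
  + apply: cvgM; first exact: cvg_cst.
    by apply: g2c; rewrite (le_trans ra t1) (le_trans t2 a_le).
  + have tr : - r <= t <= r by rewrite (le_trans ra (ltW t1)) (le_trans (ltW t2) a_le).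
    have D1 := g1d tr.
    exact: (is_deriveZ (- p0 (r - a)) D1).
rewrite (piece a r (primd (- 1)) (prim (- 1) r - prim (- 1) a))//; last 4 first.
- exact: le_trans aa.
- move=> t /andP[t1 t2] ta.
  have t0 : 0 <= t by rewrite (le_trans a_ge0).
  move: ta; rewrite ger0_norm// => ta.
  have at' : a < t by rewrite lt_neqAle eq_sym ta.
  rewrite hE ?t2 ?(le_trans _ t0) ?oppr_le0// ger0_norm// Aa ?ger0_norm//.
  by rewrite max_l ?ltW// /primd mulN1r.
- move=> t /andP[t1 t2]; apply: primdc; rewrite t2 andbT (le_trans _ t1)//.
  exact: le_trans aa.
- apply: prim_ftc; rewrite ?mulrNN ?mulr1// ?(le_trans _ aa)//.
  by move=> t /andP[t1 t2]; rewrite mulN1r; lra.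
rewrite /prim; have -> : r + 1 * - r = 0 by ring.
have -> : r + -1 * r = 0 by ring.
have -> : r + 1 * - a = r - a by ring.
have -> : r + -1 * a = r - a by ring.
by rewrite p00 p10; ring.
Qed.

End Line.

(** * Functions of class C^k near the cube *)

Section Rows.
Set Implicit Arguments. Unset Strict Implicit.
Context {R : realType} (n : nat) (r : R) (U : set 'rV[R]_n).
Hypothesis r_gt0 : 0 < r.
Hypothesis oU : open U.
Implicit Types (f g : 'rV[R]_n -> R) (y : nat -> R).

Lemma Ck_cont k f x : Ck k U f -> U x -> {for x, continuous f}.
Proof. by case: k => [|k] [cf _]; exact: cf. Qed.

Lemma CkS k f : Ck k.+1 U f -> Ck k U f.
Proof.
elim: k f => [|k IH] f [cf df]; first by split.
by split => // i; have [d c] := df i; split => //; exact: IH.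
Qed.

Lemma Ck_le k l f : (k <= l)%N -> Ck l U f -> Ck k U f.
Proof.
move=> kl; rewrite -(subnK kl); elim: (l - k)%N => // m IH.
by rewrite addSn => /CkS.
Qed.

Lemma near_open (P : 'rV[R]_n -> Prop) x :
  U x -> (forall z, U z -> P z) -> \near x, P x.
Proof.
by move=> Ux UP; apply: filterS (open_nbhs_nbhs (conj oU Ux)) => z; exact: UP.
Qed.

(** Since [U] is open, equality on [U] is equality near each of its points, which preserves
    continuity and partial derivatives. *)
Lemma eq_Ck k f g : (forall x, U x -> f x = g x) -> Ck k U f -> Ck k U g.
Proof.
elim: k f g => [|k IH] f g fg [cf df].
  split => // x Ux; rewrite /prop_for /continuous_at -fg//.
  apply: cvg_trans (cf x Ux); exact: (near_eq_cvg (near_open Ux fg)).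
split => [x Ux|i].
  rewrite /prop_for /continuous_at -fg//.
  apply: cvg_trans (cf x Ux); exact: (near_eq_cvg (near_open Ux fg)).
have [d c] := df i; split => [x Ux|].
  apply: near_eq_derivable (d x Ux); exact: (near_open Ux fg).
apply: IH c => x Ux; apply: near_eq_derive; exact: (near_open Ux fg).
Qed.

Lemma Ck_cst0 k : Ck k U (fun=> 0).
Proof.
have c0 x : U x -> {for x, continuous (fun=> 0 : R)} by move=> _; exact: cst_continuous.
elim: k => [|k IH]; split => // i; split => [x _|]; first exact: derivable_cst.
  by apply: eq_Ck IH => x _; rewrite /partial derive_cst.
Qed.

Lemma CkD k f g : Ck k U f -> Ck k U g -> Ck k U (fun x => f x + g x).
Proof.
elim: k f g => [|k IH] f g [cf df] [cg dg]; split => //.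
- by move=> x Ux; apply: continuousD; [exact: cf|exact: cg].
- by move=> x Ux; apply: continuousD; [exact: cf|exact: cg].
move=> i; have [d c] := df i; have [d' c'] := dg i; split => [x Ux|].
  by apply: derivableD; [exact: d|exact: d'].
apply: eq_Ck (IH _ _ c c') => x Ux.
by rewrite /partial -deriveD//; [exact: d|exact: d'].
Qed.

Lemma Ck_sum k (I : Type) (s : seq I) (F : I -> 'rV[R]_n -> R) :
  (forall i, Ck k U (F i)) -> Ck k U (fun x => \sum_(i <- s) F i x).
Proof.
move=> cF; elim: s => [|i s IH].
  by apply: eq_Ck (Ck_cst0 k) => x _; rewrite big_nil.
by apply: eq_Ck (CkD (cF i) IH) => x _; rewrite big_cons.
Qed.

Lemma Ck_lap k f : Ck k.+2 U f -> Ck k U (lap f).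
Proof.
by move=> [_ df]; apply: Ck_sum => i; have [_ [_ /(_ i) []]] := df i.
Qed.

Lemma Ck_iter_lap k j f : Ck (k + 2 * j) U f -> Ck k U (iter j (@lap R n) f).
Proof.
elim: j k => [|j IH] k cf; first by rewrite muln0 addn0 in cf.
by apply: Ck_lap; apply: IH; rewrite mulnS addnA addn2 in cf.
Qed.

Definition rowof (y : nat -> R) : 'rV[R]_n := \row_(l < n) y l.

Lemma rowof_shift y (i : 'I_n) (h t : R) :
  rowof (upd y i (h + t)) = h *: evec i + rowof (upd y i t).
Proof.
apply/rowP => k; rewrite !mxE /upd; case: (eqVneq k i) => [->|ki].
  by rewrite eqxx /GRing.scale/= mulr1.
by rewrite (negbTE (ki : (k : nat) != i)) mulr0 add0r.
Qed.

(** By [rowof_shift] the difference quotient along the line is the directional difference quotient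
    of [f]. *)
Lemma is_derive_line f y (i : 'I_n) (t : R) :
  derivable f (rowof (upd y i t)) (evec i) ->
  is_derive t 1 (fun t => f (rowof (upd y i t))) (partial i f (rowof (upd y i t))).
Proof.
move=> df; set u := fun t : R => rowof (upd y i t).
have E : (fun h : R => h^-1 *: (((f \o u) \o shift t) (h *: (1 : R)) - f (u t))) =
    (fun h : R => h^-1 *: ((f \o shift (u t)) (h *: evec i) - f (u t))).
  by apply/funext => h /=; rewrite -rowof_shift /GRing.scale/= mulr1.
by apply: DeriveDef; rewrite /derivable /derive /partial E.
Qed.

Lemma rowof_line_cont y (i : 'I_n) : continuous (fun t : R => rowof (upd y i t)).
Proof.
move=> t; apply/cvg_ballP => e e0; near=> s; split => // a k.
rewrite !mxE /upd; case: eqP => _; last exact: ballxx.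
by near: s; exact: (nbhsx_ballx t _ e0).
Unshelve. all: by end_near. Qed.

Lemma line_cont f y (i : 'I_n) (t : R) :
  {for rowof (upd y i t), continuous f} ->
  {for t, continuous (fun t => f (rowof (upd y i t)))}.
Proof.
move=> cf; apply: (@continuous_comp _ _ _ (fun t : R => rowof (upd y i t)) f) => //.
exact: rowof_line_cont.
Qed.

Hypothesis cubeU : @cube R r n `<=` U.

Lemma cube_rowof y : incube r y -> @cube R r n (rowof y).
Proof. by move=> yc i; rewrite mxE. Qed.

Lemma compact_cube : compact (@cube R r n).
Proof.
have -> : @cube R r n = [set v | forall i, [set` `[- r, r]] (v ord0 i)].
  by apply/seteqP; split => v /= vc i; have := vc i; rewrite in_itv/= ler_norml.
by apply: (@rV_compact R n (fun=> [set` `[- r, r]])) => i; exact: segment_compact.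
Qed.

Lemma cube_bounded f : (forall x, U x -> {for x, continuous f}) ->
  exists B, forall x, @cube R r n x -> `|f x| <= B.
Proof.
move=> cf.
have c0 : @cube R r n !=set0 by exists 0 => i; rewrite mxE normr0 ltW.
have cw : {within @cube R r n, continuous (fun x => `|f x|)}.
  apply: continuous_in_subspaceT => x; rewrite inE => /cubeU/cf cx.
  by apply: continuous_comp => //; exact: norm_continuous.
have [c _ cmax] := EVT_max_rV c0 compact_cube cw.
by exists `|f c| => x xc; apply: cmax; rewrite inE.
Qed.

(** Boundedness is compactness of the cube. For measurability only the coordinates are known to be
    measurable, so the preimage of an open interval is written as a countable union over rational
    boxes contained in an open set. *)
Lemma bmeas_rowof f : (forall x, U x -> {for x, continuous f}) ->
  bmeas r (fun y => f (rowof y)).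
Proof.
move=> cf; split; last first.
  have [B BF] := cube_bounded cf.
  by exists B => y yc; apply/BF/cube_rowof.
move=> d T h mh hc; apply: (measurability _ (RGenOpens.measurableE R)).
move=> _ [_ [a [b ->] <-]]; rewrite setTI.
(* Continuity of [f] is known on [U] only; the intersection with [U] makes [O] open. *)
pose O := [set x | U x /\ `]a, b[%classic (f x)].
have oO : open O.
  rewrite openE => x [Ux abfx]; apply: filterI.
    exact: open_nbhs_nbhs (conj oU Ux).
  by apply: (cf x Ux); apply: open_nbhs_nbhs; split => //; exact: interval_open.
pose box (q : {ffun 'I_n -> rat} * rat) :=
  [set x : 'rV[R]_n | forall j, `|x ord0 j - ratr (q.1 j)| < ratr q.2].
rewrite (_ : _ @^-1` _ = \bigcup_(q : {ffun 'I_n -> rat} * rat)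
   [set t | box q (rowof (h t)) /\ box q `<=` O]).
  apply: countable_bigcupT_measurable => // q.
  have [qO|qO] := pselect (box q `<=` O); last first.
    rewrite (_ : [set t | _] = set0); first exact: measurable0.
    by apply/seteqP; split => t // -[].
  rewrite (_ : [set t | _] = \bigcap_(j in [set: 'I_n])
      (fun t => h t j) @^-1` `](ratr (q.1 j) - ratr q.2), (ratr (q.1 j) + ratr q.2)[ ).
    apply: fin_bigcap_measurable; first exact: finite_finset.
    move=> j _; rewrite -[X in measurable X]setTI; apply: mh => //.
  apply/seteqP; split => t /=.
    move=> [bt _] j _ /=; have := bt j; rewrite mxE ltr_distl in_itv/=.
    by [].
  move=> H; split => // j; have := H j I; rewrite /= mxE ltr_distl in_itv/=.
  by [].
apply/seteqP; split => t /=; last first.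
  by move=> [q _ /= [bt /(_ _ bt)[_]]].
move=> abt; have Ot : O (rowof (h t)).
  by split => //; apply/cubeU/cube_rowof.
have [e /= e0 eO] := (nbhs_ballP _ _).1 (open_nbhs_nbhs (conj oO Ot)).
(* A box of radius [p < e / 2] whose centre is within [p] of the given point lies in the [e]-ball
   around that point. *)
have [p pe] : exists p : rat, ratr p \in `]0, (e / 2)[.
  have : 0 < e / 2 by rewrite divr_gt0.
  by move=> /rat_in_itvoo[p]; exists p.
have qP (j : 'I_n) : exists q : rat, `|h t j - ratr q| < ratr p.
  have : h t j - ratr p < h t j + ratr p.
    by rewrite ltrD2l gt0_cp; move: pe; rewrite in_itv => /andP[].
  move=> /rat_in_itvoo[q]; rewrite in_itv/= => qh; exists q.
  by rewrite distrC ltr_distl.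
have [q qh] := choice qP.
exists ([ffun j => q j], p) => //=; split => [j|x bx].
  by rewrite mxE ffunE; exact: qh.
apply: eO; split => // i j; rewrite ord1 mxE /ball/=.
have := bx j; have := qh j; rewrite ffunE.
move: pe; rewrite in_itv/= => /andP[_ pe].
set u := h t j; set v := x ord0 j; set w := ratr _ => H1 H2.
have -> : u - v = (u - w) - (v - w) by ring.
apply: le_lt_trans (ler_normB _ _) _; lra.
Qed.

End Rows.

(** * Invariance of the integral over [-r, r] under t -> -t *)

Section Reflection.
Set Implicit Arguments. Unset Strict Implicit.
Context {R : realType}.
Local Notation mu := (@lebesgue_measure R).
Local Notation opp := (-%R : measurableTypeR R -> measurableTypeR R).

Let measurable_opp : measurable_fun setT opp.
Proof. exact: oppr_measurable. Qed.

(** By uniqueness of Lebesgue measure it suffices to compare half-open intervals; reflection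
    exchanges the open and the closed end but keeps the length. *)
Lemma lebesgue_measure_opp (A : set R) : measurable A -> mu A = pushforward mu opp A.
Proof.
apply: (@lebesgue_measure_unique R
  (measure_function_pushforward__canonical__measure_function_Measure mu measurable_opp)).
move=> _ [[a b] _ <-] /=; rewrite /pushforward.
have -> : opp @^-1` `]a, b] = `[- b, - a[%classic.
  by apply/seteqP; split => x /=; rewrite !in_itv/= ltrNr lerNl => /andP[-> ->].
have -> : mu `]a, b]%classic = if a < b then (b%:E - a%:E)%E else 0%E.
  by rewrite lebesgue_measure_itv/= lte_fin.
have -> : mu `[- b, - a[%classic = if - b < - a then ((- a)%:E - (- b)%:E)%E else 0%E.
  by rewrite lebesgue_measure_itv/= lte_fin.
by rewrite ltrN2; case: ifP => // _; rewrite -!EFinB opprK addrC.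
Qed.

Lemma Rintegral_opp (r : R) (f : R -> R) : measurable_fun setT f ->
  (exists B, forall t, `|f t| <= B) ->
  \int[mu]_(t in [set t | - r <= t <= r]) f t =
  \int[mu]_(t in [set t | - r <= t <= r]) f (- t).
Proof.
move=> mf [B fB]; set D := [set t : R | _].
have mD : measurable D := measurable_seg r.
have ND : opp @^-1` D = D.
  by apply/seteqP; split => x; rewrite /D /= => /andP[h1 h2]; apply/andP; split; lra.
have mfN : measurable_fun setT (fun t : R => f (- t)).
  by apply: (measurableT_comp mf).
have iN : mu.-integrable (opp @^-1` D) ((EFin \o f) \o opp).
  rewrite ND; apply: (@bounded_integrable _ _ _ mu D (fun t : R => f (- t))) => //.
  - exact: mu_seg_lty.
  - exact: measurable_funTS.
  - by exists B.
have mEf : measurable_fun setT (EFin \o f) by apply/measurable_EFinP.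
have := integral_pushforward measurable_opp mEf iN mD.
rewrite ND /Rintegral => <-; congr fine.
by apply: eq_measure_integral => A mA _; exact: lebesgue_measure_opp.
Qed.

End Reflection.

(** * The coordinate of largest modulus *)

Section MaxCoord.
Set Implicit Arguments. Unset Strict Implicit.
Context {R : realType} (n : nat) (r : R).
Hypothesis r_gt0 : 0 < r.
Implicit Types (y : nat -> R) (P : pred 'I_n) (i j k : 'I_n).

(** With [P] the condition [k != i], this is the threshold [a] for the line in direction [i]. The
    default 0 is harmless, the entries being nonnegative. *)
Definition bmax P y : R := \big[Num.max/0]_(k < n | P k) `|y k|.

Lemma bmax_ge0 P y : 0 <= bmax P y.
Proof.
by apply: (big_ind (fun x => 0 <= x)) => // a b a0 b0; rewrite le_max a0.
Qed.

Lemma bmaxP P y c : 0 <= c -> (bmax P y <= c) = [forall k, P k ==> (`|y k| <= c)].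
Proof.
move=> c0; apply/bigmax_leP/forallP => [[_ H] k|H]; first exact/implyP/H.
by split => // k Pk; exact: (implyP (H k)).
Qed.

Lemma bmax_le P y : incube r y -> bmax P y <= r.
Proof. by move=> yc; rewrite bmaxP ?ltW//; apply/forallP => k; rewrite yc implybT. Qed.

Lemma le_bmax P y k : P k -> `|y k| <= bmax P y.
Proof. by move=> Pk; exact: (le_bigmax_cond _ (fun k : 'I_n => `|y k|)). Qed.

Lemma bmax_upd P y i t : ~~ P i -> bmax P (upd y i t) = bmax P y.
Proof.
move=> Pi; apply: eq_bigr => k Pk; rewrite updN//.
by apply: contraNneq Pi => /val_inj <-.
Qed.

Lemma Mx_rowof y : Mx (rowof n y) = bmax predT y.
Proof. by apply: eq_bigr => k _; rewrite mxE. Qed.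

Lemma bmaxD1 P y i : P i -> bmax P y = Num.max `|y i| (bmax (predD1 P i) y).
Proof.
move=> Pi; rewrite /bmax (bigmaxD1 _ _ _ Pi); congr Num.max.
by apply: eq_bigl => k; rewrite /= andbC.
Qed.

(* Ties are broken by the smallest index, so that exactly one [i] qualifies. *)
Definition fst_max P i y :=
  [forall k : 'I_n, P k ==> (if (k < i)%N then `|y k| < `|y i| else `|y k| <= `|y i|)].

Lemma fst_max_bmax P i y : P i -> fst_max P i y -> bmax P y = `|y i|.
Proof.
move=> Pi /forallP H; apply/le_anti; rewrite le_bmax// andbT bmaxP//.
apply/forallP => k; apply/implyP => Pk; have := H k; rewrite Pk /=.
by case: ifP => // _ /ltW.
Qed.

Lemma fst_max_ex P y j : P j ->
  exists i, [/\ P i, fst_max P i y & forall k, P k -> fst_max P k y -> k = i].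
Proof.
(* [Q] collects the indices in [P] that attain the maximum; its smallest element is the required
   one. *)
move=> Pj; pose Q := [pred i | P i && (bmax P y <= `|y i|)].
have [i0 Qi0] : exists i0, Q i0.
  have [i Pi mi] := @Order.TotalTheory.arg_maxP _ R _ j P (fun i : 'I_n => `|y i|) Pj.
  exists i; rewrite /Q /= Pi bmaxP//=; apply/forallP => k; apply/implyP; exact: mi.
have [i /andP[Pi mi] imin] := @arg_minnP _ i0 Q (fun i : 'I_n => i : nat) Qi0.
have fi : fst_max P i y.
  apply/forallP => k; apply/implyP => Pk; case: ltnP => ki; last first.
    exact: le_trans (le_bmax _ Pk) mi.
  apply: lt_le_trans mi; rewrite ltNge; apply/negP => mk.
  by have := imin k; rewrite /Q /= Pk mk => /(_ isT); rewrite leqNgt ki.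
exists i; split => // k Pk fk.
have := forallP fk i; have := forallP fi k; rewrite Pi Pk /=.
case: ltngtP => // [_|_|/val_inj//].
  by move=> h1 h2; have := lt_le_trans h1 h2; rewrite ltxx.
by move=> h1 h2; have := le_lt_trans h1 h2; rewrite ltxx.
Qed.

Lemma fst_max_sum P y (H : 'I_n -> R) (c : R) j : P j ->
  (forall i, P i -> fst_max P i y -> H i = c) ->
  \sum_(i < n | P i) (if fst_max P i y then H i else 0) = c.
Proof.
move=> Pj Hc; have [i [Pi fi ui]] := fst_max_ex y Pj.
rewrite (bigD1 i)//= fi (Hc _ Pi fi) big1 ?addr0// => k /andP[Pk ki].
by case: ifP => // fk; rewrite (ui k Pk fk) eqxx in ki.
Qed.

Lemma cmeas_forall (A : 'I_n -> (nat -> R) -> bool) : (forall k, cmeas r (A k)) ->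
  cmeas r (fun y => [forall k, A k y]).
Proof.
move=> mA d T h mh hc; rewrite (_ : (fun t => _) =
    fun t => \big[andb/true]_(k <- index_enum 'I_n) A k (h t)); last first.
  by apply/funext => t; rewrite big_andE; exact: eq_forallb.
elim: (index_enum _) => [|k s IH].
  rewrite (_ : (fun t => _) = fun=> true); first exact: measurable_cst.
  by apply/funext => t; rewrite big_nil.
rewrite (_ : (fun t => _) = fun t => A k (h t) && \big[andb/true]_(k <- s) A k (h t)).
  by apply: measurable_and => //; exact: mA.
by apply/funext => t; rewrite big_cons.
Qed.

Lemma cmeas_ltr (F G : (nat -> R) -> R) :
  cmeas r F -> cmeas r G -> cmeas r (fun y => F y < G y).
Proof.
by move=> mF mG d T h mh hc; apply: measurable_fun_ltr; [exact: mF|exact: mG].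
Qed.

Lemma cmeas_ler (F G : (nat -> R) -> R) :
  cmeas r F -> cmeas r G -> cmeas r (fun y => F y <= G y).
Proof.
by move=> mF mG d T h mh hc; apply: measurable_fun_ler; [exact: mF|exact: mG].
Qed.

Lemma cmeas_norm k : cmeas r (fun y => `|y k|).
Proof. by move=> d T h mh hc; apply: measurableT_comp => //; exact: mh. Qed.

Lemma cmeas_fst_max P i : cmeas r (fst_max P i).
Proof.
apply: cmeas_forall => k; case: (P k) => /=; last first.
  by move=> d T h _ _; exact: measurable_cst.
case: (k < i)%N.
  exact: (cmeas_ltr (cmeas_norm k) (cmeas_norm i)).
exact: (cmeas_ler (cmeas_norm k) (cmeas_norm i)).
Qed.

Lemma cmeas_bmax P : cmeas r (bmax P).
Proof.
move=> d T h mh hc; rewrite /bmax.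
elim: (index_enum _) => [|k s IH].
  rewrite [X in measurable_fun _ X](_ : _ = fun=> 0); first exact: measurable_cst.
  by apply/funext => t; rewrite big_nil.
rewrite [X in measurable_fun _ X](_ : _ = fun t => if P k then
    Num.max `|h t k| (\big[Num.max/0]_(j <- s | P j) `|h t j|)
  else \big[Num.max/0]_(j <- s | P j) `|h t j|).
  by case: (P k) => //; apply: measurable_maxr => //; exact: (cmeas_norm k mh hc).
by apply/funext => t; rewrite big_cons.
Qed.

(** On the cube the argument [r - bmax P y] stays in the compact interval [0, r], where [p] is
    bounded. *)
Lemma bmeas_comp_bmax P (p : R -> R) :
  continuous p -> bmeas r (fun y => p (r - bmax P y)).
Proof.
move=> cp; split.
  move=> d T h mh hc; apply: (measurableT_comp (continuous_measurable_fun cp)).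
  by apply: measurable_funB => //; exact: cmeas_bmax.
have c0 : [set` `[0, r]%R] !=set0 by exists 0; rewrite /= in_itv/= lexx ltW.
have cw : {within [set` `[0, r]], continuous (fun x => `|p x|)}.
  apply: continuous_subspaceT => x.
  by apply: continuous_comp; [exact: cp|exact: norm_continuous].
have [c _ cmax] := compact_EVT_max c0 (@segment_compact _ 0 r) cw.
exists `|p c| => y yc; apply: cmax.
by rewrite inE /= in_itv/= subr_ge0 bmax_le// gerBl bmax_ge0.
Qed.

(** With [x_j] integrated innermost, the exceptional set on each line is a pair [c], [-c], where [c]
    may depend on the other coordinates. *)
Lemma multi_int_except (S : pred nat) K j (F G : (nat -> R) -> R) y :
  (j < K)%N -> S (j : nat) -> bmeas r F -> bmeas r G -> incube r y ->
  (forall y, incube r y -> exists c, forall t, - r <= t <= r -> `|t| != c ->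
     F (upd y j t) = G (upd y j t)) ->
  multi_int r S K F y = multi_int r S K G y.
Proof.
move=> jK Sj gF gG yc H; rewrite (multi_int_pull r_gt0 jK Sj gF yc).
rewrite (multi_int_pull r_gt0 jK Sj gG yc); apply: multi_int_ext => // z zc.
have [c Hc] := H _ zc; apply: (@Rintegral_except _ _ c).
- exact: measurable_seg.
- apply/measurable_EFinP; exact: (measurable_int _ (bmeas_integrable r_gt0 j gF zc)).
- apply/measurable_EFinP; exact: (measurable_int _ (bmeas_integrable r_gt0 j gG zc)).
- exact: Hc.
Qed.

End MaxCoord.

(** * Integrals over the diagonal pieces *)

Section Diagonal.
Set Implicit Arguments. Unset Strict Implicit.
Context {R : realType} (n : nat) (r : R).
Hypothesis r_gt0 : 0 < r.
Local Notation mu := (@lebesgue_measure R).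
Implicit Types (y : nat -> R) (P : pred 'I_n) (i j k : 'I_n).

(** Splits an integral according to the first index of largest modulus in [P]; [H i] has to agree
    with [H0] only where [i] is that index. *)
Lemma multi_int_fst_max P (S : pred nat) K (H0 : (nat -> R) -> R)
    (H : 'I_n -> (nat -> R) -> R) j y :
  P j -> (forall i, P i -> bmeas r (H i)) ->
  (forall i y, incube r y -> P i -> fst_max P i y -> H i y = H0 y) ->
  incube r y ->
  multi_int r S K H0 y =
  \sum_(i < n | P i) multi_int r S K (fun y => if fst_max P i y then H i y else 0) y.
Proof.
move=> Pj gH HH yc; rewrite -multi_int_sum//; last first.
  move=> i Pi; apply: bmeas_if; [exact: cmeas_fst_max|exact: gH|exact: bmeas_cst].
apply: multi_int_ext => // z zc; apply/esym/(fst_max_sum Pj) => i Pi fi.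
exact: HH.
Qed.

Lemma bmax_line y i t :
  @bmax R n predT (upd y i t) = Num.max `|t| (bmax (fun k : 'I_n => k != i) y).
Proof.
rewrite (@bmaxD1 _ _ predT _ i)// updE bmax_upd ?inE ?eqxx//.
by congr Num.max; apply: eq_bigl => k; rewrite inE /= andbT.
Qed.

(** The condition in [Dij_int] in boolean form; unlike [fst_max], it does not break ties. *)
Definition wk_max i j y := [forall k, (k != i) ==> (k != j) ==> (`|y k| <= `|y j|)].

Lemma cmeas_wk_max i j : cmeas r (wk_max i j).
Proof.
apply: cmeas_forall => k.
case: (k != i) => /=; last by move=> d T h _ _; exact: measurable_cst.
case: (k != j) => /=; last by move=> d T h _ _; exact: measurable_cst.
exact: (cmeas_ler (cmeas_norm k) (cmeas_norm j)).
Qed.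

Lemma wk_max_line i j y t : i != j ->
  wk_max i j (upd y j t) = (bmax (fun k : 'I_n => (k != i) && (k != j)) y <= `|t|).
Proof.
move=> ij; rewrite bmaxP// /wk_max; apply: eq_forallb => k; rewrite updE.
case: (k != i) => //=; case: (eqVneq k j) => //= kj; rewrite updN//.
Qed.

Lemma fst_max_wk_max i j y : fst_max (fun k : 'I_n => k != i) j y -> wk_max i j y.
Proof.
move=> /forallP H; apply/forallP => k; apply/implyP => ki; apply/implyP => _.
by have := H k; rewrite ki /=; case: ifP => // _ /ltW.
Qed.

Lemma wk_max_fst_max i j y t : i != j ->
  bmax (fun k : 'I_n => (k != i) && (k != j)) y < `|t| ->
  fst_max (fun k : 'I_n => k != i) j (upd y j t).
Proof.
move=> ij bt; apply/forallP => k; apply/implyP => ki; rewrite updE.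
case: (eqVneq k j) => [->|kj]; first by rewrite ltnn updE.
have kjv : (k : nat) != j by [].
rewrite (updN _ _ kjv).
have kt : `|y k| < `|t| by apply: le_lt_trans bt; apply: le_bmax; rewrite ki kj.
by case: ifP => // _; exact: ltW.
Qed.

Lemma Dij_intE i j (f : 'rV[R]_n -> R) :
  Dij_int r i j f = multi_int r (fun k : nat => k != i) n (fun y =>
    if wk_max i j y then f (rowof n (upd y i (y j))) + f (rowof n (upd y i (- y j)))
    else 0) (fun=> 0).
Proof.
rewrite /Dij_int iintE; congr (multi_int r _ n _ _); apply/funext => x.
have -> : `[< forall k : 'I_n, k != i -> k != j -> `|x k| <= `|x j| >] = wk_max i j x.
  apply/asboolP/forallP => [H k|H k ki kj].
    by apply/implyP => ki; apply/implyP => kj; exact: H.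
  by have := H k; rewrite ki kj.
by case: ifP => // _; congr (f _ + f _); apply/rowP => l; rewrite !mxE.
Qed.

Variable f : 'rV[R]_n -> R.
Hypothesis gf : bmeas r (fun y => f (rowof n y)).

(** Used with [s] the identity and the negation, for the two sheets [x_i = x_j] and
    [x_i = - x_j]. *)
Lemma bmeas_refl (s : R -> R) i j :
  measurable_fun setT s -> (forall t, `|s t| = `|t|) ->
  bmeas r (fun y => f (rowof n (upd y i (s (y j))))).
Proof.
move=> ms sn.
apply: (@bmeas_subst _ _ (fun y => f (rowof n y)) (fun y => upd y i (s (y j)))).
- move=> k d T h mh hc; rewrite /upd; case: eqP => _; last exact: mh.
  exact: (measurableT_comp ms (mh j)).
- by move=> y yc; apply: incube_upd => //; rewrite -ler_norml sn.
- exact: gf.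
Qed.

Lemma bmeas_pair i j :
  bmeas r (fun y => f (rowof n (upd y i (y j))) + f (rowof n (upd y i (- y j)))).
Proof.
apply: bmeasD; first exact: (@bmeas_refl id).
by apply: (@bmeas_refl -%R) => // t; rewrite normrN.
Qed.

(** The two tests can differ only where [|x_j|] equals the largest modulus of the coordinates other
    than [x_i] and [x_j]: a null set in the variable [x_j]. *)
Lemma fst_max_Dij_int i j : i != j ->
  multi_int r (fun k : nat => k != i) n (fun y =>
    if fst_max (fun k : 'I_n => k != i) j y then
      f (rowof n (upd y i (y j))) + f (rowof n (upd y i (- y j))) else 0) (fun=> 0) =
  Dij_int r i j f.
Proof.
move=> ij; rewrite Dij_intE; apply: (@multi_int_except _ _ _ r_gt0 _ _ j) => //.
- by rewrite eq_sym.
- by apply: bmeas_if; [exact: cmeas_fst_max|exact: bmeas_pair|exact: bmeas_cst].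
- by apply: bmeas_if; [exact: cmeas_wk_max|exact: bmeas_pair|exact: bmeas_cst].
- exact: incube0.
move=> y yc; exists (bmax (fun k : 'I_n => (k != i) && (k != j)) y) => t _ tb.
rewrite wk_max_line//; case: leP => [bt|tb'].
  by rewrite wk_max_fst_max// lt_neqAle eq_sym tb.
case: ifP => // /fst_max_wk_max; by rewrite wk_max_line// leNgt tb'.
Qed.

(** On the sheet [x_i = x_j] the two parametrizations differ by renaming the variable, on
    [x_i = - x_j] by the reflection [t -> - t]. *)
Lemma Dij_intC i j : i != j -> Dij_int r i j f = Dij_int r j i f.
Proof.
move=> ij; have ji : j != i by rewrite eq_sym.
pose W (s : R -> R) i j y := if wk_max i j y then f (rowof n (upd y i (s (y j)))) else 0.
have gW (s : R -> R) i' j' : measurable_fun setT s -> (forall t, `|s t| = `|t|) ->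
    bmeas r (W s i' j').
  move=> ms sn; apply: bmeas_if; [exact: cmeas_wk_max| |exact: bmeas_cst].
  exact: bmeas_refl.
have gid i' j' : bmeas r (W id i' j') by exact: gW.
have gop i' j' : bmeas r (W -%R i' j') by apply: gW => // t; rewrite normrN.
(* The two sheets are separated, with the shared variable integrated innermost. *)
have DW i' j' : i' != j' -> Dij_int r i' j' f =
    multi_int r (predD1 (fun k : nat => k != i') (j' : nat)) n
      (coord_int r j' (W id i' j')) (fun=> 0) +
    multi_int r (predD1 (fun k : nat => k != i') (j' : nat)) n
      (coord_int r j' (W -%R i' j')) (fun=> 0).
  move=> ij'; rewrite Dij_intE; have z0 := incube0 r_gt0.
  rewrite -!(@multi_int_pull _ _ r_gt0 (fun k : nat => k != i') n j')//;
    try by rewrite eq_sym.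
  rewrite -multi_intD//; apply: multi_int_ext => // y yc.
  by rewrite /W; case: ifP => //; rewrite addr0.
rewrite !DW//.
have -> : multi_int r (predD1 (fun k : nat => k != j) (i : nat)) n =
          multi_int r (predD1 (fun k : nat => k != i) (j : nat)) n.
  by apply/funext => F; apply: eq_multi_int => k _ /=; rewrite andbC.
have wkC y t t' : `|t| = `|t'| -> wk_max j i (upd y i t) = wk_max i j (upd y j t').
  move=> tt; rewrite !wk_max_line// tt; congr (_ <= _); apply: eq_bigl => k.
  by rewrite andbC.
congr (_ + _); apply: multi_int_ext; try exact: incube0; move=> y yc.
  apply: eq_Rintegral => t _; rewrite /W (wkC y t t)// !updE.
  by case: ifP => // _; rewrite updC//.
have := @Rintegral_opp R r (fun t => W -%R i j (upd y j (clamp r t))) _ _.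
rewrite /coord_int => E.
transitivity (\int[mu]_(t in [set t | - r <= t <= r]) W -%R i j (upd y j (clamp r t))).
  by apply: eq_Rintegral => t /[!inE] tD; rewrite (clamp_id _ _ tD).
have cc t : incube r (upd y j (clamp r t)).
  by apply: incube_upd; rewrite // -ler_norml clamp_norm.
have [mW [B WB]] := gop i j.
rewrite E.
- apply: eq_Rintegral => t /[!inE] tD.
  have tD' : - r <= - t <= r by case/andP: tD => *; apply/andP; split; lra.
  rewrite (clamp_id _ _ tD') /W (wkC y t (- t)) ?normrN// !updE opprK.
  by case: ifP => // _; rewrite updC//.
- apply: (mW _ _ (fun t => upd y j (clamp r t))) => // k.
  by rewrite /upd; case: eqP => _ //; exact: measurable_clamp.
- by exists B => t; exact: WB.
Qed.

End Diagonal.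

(** * The identity for one Laplacian *)

Section GreenCube.
Set Implicit Arguments. Unset Strict Implicit.
Context {R : realType} (n : nat) (r : R) (U : set 'rV[R]_n).
Hypotheses (n_ge2 : (2 <= n)%N) (r_gt0 : 0 < r) (oU : open U).
Hypothesis cubeU : @cube R r n `<=` U.
Variables (p0 p1 p2 : R -> R) (G : 'rV[R]_n -> R).
Hypotheses (p0c : continuous p0) (p1c : continuous p1) (p2c : continuous p2).
Hypothesis p0d : forall x : R, 0 < x < r -> is_derive x 1 p0 (p1 x).
Hypothesis p1d : forall x : R, 0 < x < r -> is_derive x 1 p1 (p2 x).
Hypotheses (p00 : p0 0 = 0) (p10 : p1 0 = 0).
Hypothesis G2 : Ck 2 U G.
Local Notation mu := (@lebesgue_measure R).
Implicit Types (y : nat -> R) (i j k : 'I_n).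

Let in_U y : incube r y -> U (rowof n y).
Proof. by move=> yc; apply/cubeU/cube_rowof. Qed.

Let bmeas_max_mul (p : R -> R) (g : 'rV[R]_n -> R) :
  continuous p -> (forall x, U x -> {for x, continuous g}) ->
  bmeas r (fun y => p (r - Mx (rowof n y)) * g (rowof n y)).
Proof.
move=> cp cg; apply: (eq_bmeas (bmeasM (bmeas_comp_bmax r_gt0 predT cp)
  (bmeas_rowof r_gt0 oU cubeU cg))) => y.
by rewrite Mx_rowof.
Qed.

Let Gc x : U x -> {for x, continuous G}. Proof. exact: Ck_cont G2. Qed.

Let Gd i x : U x -> derivable G x (evec i).
Proof. by case: G2 => _ /(_ i)[H _] /H. Qed.

Let dGd i x : U x -> derivable (partial i G) x (evec i).
Proof. by case: G2 => _ /(_ i)[_ [_ /(_ i)[H _]]] /H. Qed.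

Let ddGc i x : U x -> {for x, continuous (partial i (partial i G))}.
Proof. by case: G2 => _ /(_ i)[_ [_ /(_ i)[_ [H _]]]] /H. Qed.

Let f x := p1 (r - Mx x) * G x.
Let gf : bmeas r (fun y => f (rowof n y)) := bmeas_max_mul p1c Gc.

(** [hA i] is the share of the [p2] integrand assigned to direction [i], and [hB i] is the [i]-th
    term of the Laplacian integrand. *)
Let hA i y := if fst_max predT i y then p2 (r - Mx (rowof n y)) * G (rowof n y) else 0.
Let hB i y := p0 (r - Mx (rowof n y)) * partial i (partial i G) (rowof n y).

Let bmeas_hA i : bmeas r (hA i).
Proof.
apply: bmeas_if; [exact: cmeas_fst_max| |exact: bmeas_cst].
exact: bmeas_max_mul p2c Gc.
Qed.

Let bmeas_hB i : bmeas r (hB i).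
Proof. exact: bmeas_max_mul p0c (@ddGc i). Qed.

Let b i y := bmax (fun k : 'I_n => k != i) y.

(** This is [line_green] with [fst_max] as the test [A]: it holds for [|x_i|] above [b i y] and
    fails below; at equality its value is immaterial. *)
Let hAB_line i y : incube r y ->
  coord_int r i (fun y => hA i y - hB i y) y =
  p1 (r - b i y) * (G (rowof n (upd y i (b i y))) + G (rowof n (upd y i (- b i y)))).
Proof.
move=> yc; rewrite /coord_int.
have b0 : 0 <= b i y := bmax_ge0 _ _.
have br : b i y <= r := bmax_le r_gt0 _ yc.
have inU t : - r <= t <= r -> U (rowof n (upd y i t)).
  by move=> tr; apply/in_U/incube_upd.
apply: (@line_green R r (b i y) p0 p1 p2 (fun t => G (rowof n (upd y i t)))
   (fun t => partial i G (rowof n (upd y i t)))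
   (fun t => partial i (partial i G) (rowof n (upd y i t)))
   b0 br p0c p1c p2c p0d p1d p00 p10 _ _ _ (fun t => fst_max predT i (upd y i t))).
- by move=> t tr; apply/is_derive_line/Gd/inU.
- by move=> t tr; apply/is_derive_line/dGd/inU.
- by move=> t tr; apply/line_cont/ddGc/inU.
- by move=> t _; rewrite /hA /hB Mx_rowof bmax_line.
- move=> t bt; apply/forallP => k; apply/implyP => _; rewrite updE.
  case: (eqVneq k i) => [->|ki]; first by rewrite ltnn updE.
  have kt : `|upd y i t k| < `|t|.
    rewrite (updN _ _ (ki : (k : nat) != i)); apply: le_lt_trans bt; exact: le_bmax.
  by case: ifP => // _; exact: ltW.
- move=> t tb; apply/negP => /(fst_max_bmax isT); rewrite bmax_line updE => E.
  have bt : b i y <= `|t| by rewrite -E le_max lexx orbT.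
  by rewrite ltNge bt in tb.
- apply: (@bmeas_integrable _ _ r_gt0 (fun y => hA i y - hB i y)) => //.
  by apply: bmeasD => //; exact: bmeasN.
Qed.

(** Integrating over [x_i] first leaves a function of the other coordinates, which is then split
    according to the index [j] of largest modulus among them. *)
Let pieceE i : multi_int r predT n (hA i) (fun=> 0) =
  multi_int r predT n (hB i) (fun=> 0) + \sum_(j < n | j != i) Dij_int r i j f.
Proof.
have z0 := incube0 r_gt0.
have gAB : bmeas r (fun y => hA i y - hB i y) by apply: bmeasD => //; exact: bmeasN.
have -> : multi_int r predT n (hA i) (fun=> 0) = multi_int r predT n (hB i) (fun=> 0) +
    multi_int r predT n (fun y => hA i y - hB i y) (fun=> 0).
  rewrite -multi_intD//; apply: multi_int_ext => // y _.
  by rewrite addrC subrK.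
congr (_ + _); rewrite (multi_int_pull r_gt0 (ltn_ord i) _ gAB)//.
have -> : multi_int r (predD1 predT (i : nat)) n = multi_int r (fun k : nat => k != i) n.
  by apply/funext => F; apply: eq_multi_int => k _; rewrite /= andbT.
(* Here [n >= 2] enters: the splitting over [j != i] needs at least one index. *)
have [j0 j0i] : exists j, j != i.
  have n_gt0 : (0 < n)%N by exact: ltnW.
  case: (eqVneq (Ordinal n_gt0) i) => [<-|]; last by exists (Ordinal n_gt0).
  by exists (Ordinal n_ge2).
rewrite (@multi_int_fst_max _ _ _ r_gt0 (fun j => j != i) _ _ _
  (fun j y => f (rowof n (upd y i (y j))) + f (rowof n (upd y i (- y j)))) _ _ j0i)//.
- by apply: eq_bigr => j ji; apply: fst_max_Dij_int => //; rewrite eq_sym.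
- by move=> j _; exact: bmeas_pair.
move=> j y yc ji fj; rewrite hAB_line// /f !Mx_rowof !bmax_line.
(* Since [b i y] is [|y j|], the points at [b i y] and [- b i y] are those at [y j] and [- y j],
   swapped when [y j] is negative. *)
have bE : b i y = `|y j| by exact: fst_max_bmax fj.
rewrite -/(b i y) bE normrN maxxx -mulrDr; congr (_ * _).
by case: (ger0P (y j)) => _ //; rewrite opprK addrC.
Qed.

Lemma green_cube :
  cube_int r (fun x => p2 (r - Mx x) * G x) =
  cube_int r (fun x => p0 (r - Mx x) * lap G x) + 2 * Dn_int r f.
Proof.
have z0 := incube0 r_gt0; have n_gt0 : (0 < n)%N by exact: ltnW.
rewrite /cube_int !iintE.
rewrite (@multi_int_fst_max _ _ _ r_gt0 predT predT n _
  (fun i y => p2 (r - Mx (rowof n y)) * G (rowof n y)) (Ordinal n_gt0))//; last first.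
  by move=> i _; exact: bmeas_max_mul.
have -> : multi_int r predT n
    (fun y => p0 (r - Mx (rowof n y)) * lap G (rowof n y)) (fun=> 0) =
    \sum_(i < n) multi_int r predT n (hB i) (fun=> 0).
  rewrite -multi_int_sum//. apply: multi_int_ext => // y yc.
  by rewrite /lap mulr_sumr.
rewrite (eq_bigr _ (fun i _ => pieceE i)) big_split /=; congr (_ + _).
rewrite /Dn_int mulr_natl mulr2n.
have -> : \sum_(i < n) \sum_(j < n | j != i) Dij_int r i j f =
   \sum_(i < n) \sum_(j < n | (i < j)%N) Dij_int r i j f +
   \sum_(i < n) \sum_(j < n | (j < i)%N) Dij_int r i j f.
  rewrite -big_split /=; apply: eq_bigr => i _.
  rewrite (bigID (fun j : 'I_n => (i < j)%N)) /=; congr (_ + _); apply: eq_bigl => j.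
    by rewrite -(inj_eq val_inj) neq_ltn /=; case: ltngtP.
  by rewrite -(inj_eq val_inj) neq_ltn /=; case: ltngtP.
(* Exchanging the sums and using the symmetry of [Dij_int] identifies the part [j < i] with the part
   [i < j], whence the factor 2. *)
congr (_ + _); rewrite [LHS](exchange_big_dep xpredT)//=.
apply: eq_bigr => i _; apply: eq_bigr => j ij.
by rewrite (Dij_intC r_gt0 gf)// -(inj_eq val_inj) /= gtn_eqF.
Qed.

End GreenCube.

(** * The theorem *)

Section Extension.
Set Implicit Arguments. Unset Strict Implicit.
Context {R : realType} (r : R).
Hypothesis r_gt0 : 0 < r.

(* Precomposition with [clip] turns the functions given on [0,r] into continuous
   functions on R without changing their derivatives on ]0,r[. *)
Definition clip (t : R) : R := Num.max 0 (Num.min t r).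

Lemma clip_id t : 0 <= t <= r -> clip t = t.
Proof. by move=> /andP[a b]; rewrite /clip min_l// max_r. Qed.

Lemma clip_itv t : 0 <= clip t <= r.
Proof. by rewrite /clip le_max lexx/= ge_max ge_min lexx orbT andbT ltW. Qed.

Lemma continuous_clip : continuous clip.
Proof.
apply: (@max_fun_continuous _ _ R (cst 0) (id \min cst r)).
  exact: cst_continuous.
apply: (@min_fun_continuous _ _ R id (cst r)); last exact: cst_continuous.
by move=> t; exact: cvg_id.
Qed.

(** As [clip] takes all its values in [0, r], continuity of [p] within that interval suffices at
    every real point. *)
Lemma continuous_comp_clip (p : R -> R) :
  {within [set t | 0 <= t <= r], continuous p} -> continuous (p \o clip).
Proof.
move=> /subspace_continuousP cp t; have ct := cp _ (clip_itv t).
apply: (cvg_comp clip p) ct => V /= VA.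
apply: (@filterS _ (nbhs t) _ (clip @^-1` (fun s => 0 <= s <= r -> V s))).
  by move=> s; apply; exact: clip_itv.
exact: continuous_clip VA.
Qed.

Lemma is_derive_comp_clip (p p' : R -> R) (x : R) :
  deriv_on 0 r p p' -> 0 < x < r -> is_derive x 1 (p \o clip) ((p' \o clip) x).
Proof.
move=> dp x0r; have /andP[x0 xr] := x0r.
rewrite /= clip_id ?(ltW x0) ?ltW//.
apply: near_eq_is_derive (deriv_on_is_derive dp x0r).
near=> z; rewrite /= clip_id//; apply/andP; split; apply: ltW; near: z.
  exact: lt_nbhsr.
exact: lt_nbhsl.
Unshelve. all: by end_near. Qed.

Lemma eq_cube_int n (f h : 'rV[R]_n -> R) :
  (forall x, cube r x -> f x = h x) -> cube_int r f = cube_int r h.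
Proof.
move=> fh; rewrite /cube_int !iintE; apply: multi_int_ext; last exact: incube0.
by move=> y yc; apply/fh/cube_rowof.
Qed.

Lemma eq_Dn_int n (f h : 'rV[R]_n -> R) :
  (forall x, cube r x -> f x = h x) -> Dn_int r f = Dn_int r h.
Proof.
move=> fh; apply: eq_bigr => i _; apply: eq_bigr => j _.
rewrite !Dij_intE; apply: multi_int_ext; last exact: incube0.
move=> y yc; case: ifP => // _; congr (_ + _); apply/fh/cube_rowof/incube_upd => //.
  by rewrite -ler_norml.
by rewrite -ler_norml normrN.
Qed.

Lemma Mx_cube n (x : 'rV[R]_n) : cube r x -> 0 <= r - Mx x <= r.
Proof.
move=> xc; rewrite subr_ge0 gerBl; apply/andP; split.
  by apply/bigmax_leP; split=> [|i _]; [exact: ltW|exact: xc].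
by apply: (big_ind (fun z => 0 <= z)) => // a b a0 b0; rewrite le_max a0.
Qed.

End Extension.

(* phi k stands for the k-th derivative phi^(k) of phi = phi 0 on [0,r] *)
Theorem theorem2 (R : realType) (n m : nat) (r : R)
    (U : set 'rV[R]_n) (g : 'rV[R]_n -> R) (phi : nat -> R -> R) :
  (2 <= n)%N -> 0 < r -> (1 <= m)%N ->
  open U -> connected U -> @cube R r n `<=` U ->
  Ck (2 * m) U g ->
  (forall x, U x -> iter m (@lap R n) g x = 0) ->
  (forall k, (k <= 2 * m)%N -> {within [set t | 0 <= t <= r], continuous (phi k)}) ->
  (forall k, (k < 2 * m)%N -> deriv_on 0 r (phi k) (phi k.+1)) ->
  (forall k, (k < 2 * m)%N -> phi k 0 = 0) ->
  cube_int r (fun x => phi (2 * m)%N (r - Mx x) * g x) =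
  2 * \sum_(s < m)
        Dn_int r (fun x => phi (2 * s + 1)%N (r - Mx x) * iter (m - s - 1) (@lap R n) g x).
Proof.
move=> n2 r0 m1 oU _ cU Cg gm phic phid phi0.
(* The telescoping quantity: [T m] is the left-hand side, and [T 0] vanishes because it contains the
   [m]-th iterated Laplacian of [g]. *)
pose T j := cube_int r (fun x =>
  phi (2 * j)%N (r - Mx x) * iter (m - j) (@lap R n) g x).
pose E s := Dn_int r (fun x =>
  phi (2 * s + 1)%N (r - Mx x) * iter (m - s - 1) (@lap R n) g x).
have step j : (j < m)%N -> T j.+1 = T j + 2 * E j.
  move=> jm; pose q k := phi k \o clip r.
  have le2 : (2 * j.+1 <= 2 * m)%N by rewrite leq_mul2l.
  have k1 : (2 * j + 1 < 2 * m)%N by rewrite (leq_trans _ le2)// mulnS addnC.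
  have k0 : (2 * j < 2 * m)%N by rewrite (leq_trans _ k1)// addn1.
  have e1 : (2 * j + 1 = (2 * j).+1)%N by rewrite addn1.
  have e2 : (2 * j.+1 = (2 * j + 1).+1)%N by rewrite mulnS addnC addn1 addn2.
  have eA : (m - j = (m - j - 1).+1)%N by rewrite subn1 prednK// subn_gt0.
  (* Two derivatives must remain after [m - j - 1] Laplacians: this takes [2 * (m - j)] derivatives
     of [g], at most the available [2 * m]. *)
  have GC : Ck 2 U (iter (m - j - 1) (@lap R n) g).
    apply: (Ck_iter_lap oU); apply: (Ck_le _ Cg).
    have e : (2 + 2 * (m - j - 1) = 2 * (m - j))%N by rewrite {2}eA mulnS.
    by rewrite e leq_mul2l leq_subr.
  have qx k x : cube r x -> q k (r - Mx x) = phi k (r - Mx x).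
    by move=> xc; rewrite /q /= clip_id// Mx_cube.
  have q0 k : (k < 2 * m)%N -> q k 0 = 0.
    by move=> km; rewrite /q /= clip_id ?lexx ?ltW// phi0.
  (* On the cube [r - Mx x] lies in [0, r], so each [phi k] may be replaced by its clipped version
     [q k], to which [green_cube] applies. *)
  transitivity (cube_int r (fun x =>
      q (2 * j.+1)%N (r - Mx x) * iter (m - j - 1) (@lap R n) g x)).
    by apply: eq_cube_int => // x xc; rewrite qx// subnS subn1.
  have qc k : (k <= 2 * m)%N -> continuous (q k).
    by move=> km; apply: continuous_comp_clip => //; exact: phic.
  have qd k : (k < 2 * m)%N ->
      forall x : R, 0 < x < r -> is_derive x 1 (q k) (q k.+1 x).
    by move=> km x xr; apply: is_derive_comp_clip => //; exact: phid.
  have qd0 := qd _ k0; rewrite -e1 in qd0.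
  have qd1 := qd _ k1; rewrite -e2 in qd1.
  rewrite (green_cube n2 r0 oU cU (qc _ (ltnW k0)) (qc _ (ltnW k1)) (qc _ le2)
    qd0 qd1 (q0 _ k0) (q0 _ k1) GC).
  congr (_ + 2 * _).
    by apply: eq_cube_int => // x xc; rewrite qx// [in RHS]eA iterS.
  by apply: eq_Dn_int => // x xc; rewrite qx.
have T0 : T 0%N = 0.
  rewrite /T subn0 (_ : cube_int _ _ = cube_int r (fun _ : 'rV[R]_n => 0)).
    by rewrite /cube_int iintE multi_int_cst0.
  by apply: eq_cube_int => // x /cU Ux; rewrite gm// mulr0.
have TE j : (j <= m)%N -> T j = 2 * \sum_(s < j) E s.
  elim: j => [_|j IH jm]; first by rewrite T0 big_ord0 mulr0.
  by rewrite step// IH ?(ltnW jm)// big_ord_recr /= mulrDr.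
by have := TE m (leqnn m); rewrite /T subnn.
Qed.
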